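(* Let $X$ be a Banach space and let $U:T\to\mathcal{B}(X)$ be an evolution operator. Then $U$ is weakly exponentially unstable if and only if there are constants $p,M,K\geq 1$ and $\omega>0$ such that for each $x_0\in X$ there is $t_0\geq 0$ for which both of the following hold: (i) $\|U(s,t_0)x_0\|\leq M e^{\omega(t-s)}\|U(t,t_0)x_0\|$ for all $t\geq s\geq t_0$; (ii) $\int_{t_0}^{t}\|U(\tau,t_0)x_0\|^{p}\,d\tau\leq K\|U(t,t_0)x_0\|^{p}$ for all $t\geq t_0$.
   Context: $X$ is a Banach space, $\mathcal{B}(X)$ is the Banach algebra of all bounded linear operators on $X$, $\mathbb{R}_+=[0,\infty)$, and $T=\{(t,s)\in\mathbb{R}_+^2 : t\geq s\}$. A map $U:T\to\mathcal{B}(X)$ is an evolution operator if: $U(t,t)=I$ (the identity on $X$) for every $t\geq 0$; $U(t,s)U(s,t_0)=U(t,t_0)$ for all $(t,s),(s,t_0)\in T$; and for each $x\in X$ the function $T\ni(t,s)\mapsto U(t,s)x\in X$ is continuous. An evolution operator $U$ is weakly exponentially unstable if there are constants $N\geq 1$ and $\nu>0$ such that for each $x_0\in X$ there is $t_0=t_0(x_0)\geq 0$ with $N\|U(t,t_0)x_0\|\geq e^{\nu(t-s)}\|U(s,t_0)x_0\|$ for all $t\geq s\geq t_0$. *)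

(* Defs.v *)
From HB Require Import structures.
From mathcomp Require Import all_boot all_order all_algebra.
From mathcomp Require Import all_classical all_reals all_analysis.
Set Implicit Arguments.
Unset Strict Implicit.
Unset Printing Implicit Defensive.
Import Order.TTheory GRing.Theory Num.Theory.
Import numFieldNormedType.Exports.
Local Open Scope classical_set_scope.
Local Open Scope ring_scope.

Definition time_domain (R : realType) : set (R * R) :=
  [set ts | 0 <= ts.2 /\ ts.2 <= ts.1].

Definition bounded_operator (R : realType) (X : normedModType R)
    (A : {linear X -> X}) : Prop :=
  exists C : R, forall x : X, `|A x| <= C * `|x|.

(* A map defined on the time domain is encoded as a total function of two real
   arguments: every condition, boundedness included, is imposed only on the
   time domain, so the values elsewhere are irrelevant. Scalars are real; a
   complex Banach space is covered through its underlying real structure, as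
   the operators need only be real-linear. *)
Record evolution_operator (R : realType) (X : completeNormedModType R)
    (U : R -> R -> {linear X -> X}) : Prop := {
  evolution_bounded : forall t s : R,
    time_domain (t, s) -> bounded_operator (U t s);
  evolution_id : forall t : R, 0 <= t -> U t t =1 idfun;
  evolution_comp : forall t s t0 : R,
    time_domain (t, s) -> time_domain (s, t0) -> U t s \o U s t0 =1 U t t0;
  evolution_continuous : forall x : X,
    {within @time_domain R, continuous (fun ts : R * R => U ts.1 ts.2 x)} }.

Definition weakly_exponentially_unstable (R : realType)
    (X : completeNormedModType R) (U : R -> R -> {linear X -> X}) : Prop :=
  exists N nu : R, [/\ 1 <= N, 0 < nu &
    forall x0 : X, exists2 t0 : R, 0 <= t0 &
      forall t s : R, t0 <= s -> s <= t ->
        expR (nu * (t - s)) * `|U s t0 x0| <= N * `|U t t0 x0|].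

(* Main.v *)
Require Import Defs.
From HB Require Import structures.
From mathcomp Require Import all_boot all_order all_algebra.
From mathcomp Require Import all_classical all_reals all_analysis.
From mathcomp Require Import measurable_realfun.
From mathcomp Require Import ring lra.
Set Implicit Arguments.
Unset Strict Implicit.
Unset Printing Implicit Defensive.
Import Order.TTheory GRing.Theory Num.Theory.
Import numFieldNormedType.Exports.
Local Open Scope classical_set_scope.
Local Open Scope ring_scope.

(** Fix [x0] and [t0] and write [g t] for [`|U t t0 x0|]; both sides of the equivalence
    speak only of this nonnegative function on [t0, +oo[.

    If [g] grows exponentially, read backwards in time it decays: [g tau] is at
    most [N * g t * expR (- nu * (t - tau))] for [tau <= t].  This gives (i) with
    [M = N] and [omega = nu], and (ii) with [p = 1], because that
    exponential has integral at most [1 / nu] over [t0, t] ([integral_expR_decay]).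

    The converse is Datko's argument, and uses no differentiation: all that is
    extracted from (ii) is that [g] cannot stay above a level [c] on an interval
    of length [l] before time [t] unless [l * c `^ p <= K * g t `^ p]
    ([powR_lower_bound_of_integral_bound]).  It is used twice.
    - By (i), [g] stays above [g s / (M * expR omega)] on [s, s + 1].  Taking
      [l = 1] shows that [g s <= B * g t] for all later [t], with a constant [B]
      which, unlike the one in (i), does not depend on [t - s].
    - Hence [g] stays above [g s / B] on [s, s + L] for every [L], and if [L] is
      large enough this forces [g (s + L) >= expR 1 * g s].
    Growth by a fixed factor over every period [L], together with the bound [B]
    inside a period, is exponential growth
    ([exponential_growth_of_periodic_growth]).  All the constants are functions
    of [p], [M], [K], [omega] alone, so they serve every [x0]. *)

(** * Measurability of the orbits *)

Lemma within_continuous_comp_subset (S T V : topologicalType) (A : set S)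
    (B : set T) (f : S -> T) (g : T -> V) :
  f @` A `<=` B -> {within A, continuous f} -> {within B, continuous g} ->
  {within A, continuous (g \o f)}.
Proof.
move=> fAB /subspace_continuousP cf /subspace_continuousP cg.
apply/subspace_continuousP => x Ax.
have Bfx : B (f x) by apply: fAB; exists x.
apply: (@cvg_comp _ _ _ f g _ (within B (nbhs (f x)))); last exact: cg.
move=> P BP.
have H : \forall y \near x, A y -> B (f y) -> P (f y) := cf x Ax _ BP.
change (\forall y \near x, A y -> P (f y)).
by apply: filterS H => y BPy Ay; apply: BPy => //; apply: fAB; exists y.
Qed.

(** Joint strong continuity is only given on the time domain, so continuity of
    an orbit is continuity relative to [[t0, t]], where [tau |-> (tau, t0)]
    takes its values in that domain. *)
Lemma measurable_trajectory_norm (R : realType) (X : completeNormedModType R)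
    (U : R -> R -> {linear X -> X}) (hU : evolution_operator U)
    (x : X) (t0 t : R) :
  0 <= t0 -> measurable_fun `[t0, t] (fun tau => `|U tau t0 x|).
Proof.
move=> t0_ge0; apply: subspace_continuous_measurable_fun => //.
apply: (@within_continuous_comp_subset _ _ _ _ setT (fun tau => U tau t0 x)
  (fun y : X => `|y|)) => //.
  apply: (@within_continuous_comp_subset _ _ _ _ (@time_domain R)
    (fun tau => (tau, t0)) (fun ts : R * R => U ts.1 ts.2 x)).
  - move=> _ [tau /= + <-]; rewrite in_itv/= => /andP[t0tau _].
    by split.
  - apply: continuous_subspaceT => tau.
    exact: (cvg_pair (@cvg_id _ (nbhs tau)) (cvg_cst t0)).
  - exact: evolution_continuous hU x.
by apply: continuous_subspaceT; exact: norm_continuous.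
Qed.

(** * Integral of a decaying exponential *)

Lemma is_derive_expR_decay (R : realType) (nu c b x : R) :
  is_derive x 1 (fun y => c * expR (- nu * (b - y)))
    (c * nu * expR (- nu * (b - x))).
Proof.
have lin : is_derive x 1 (fun y : R => - nu * (b - y)) nu.
  by apply: is_derive_eq; rewrite /GRing.scale/=; ring.
have e := is_derive1_comp (is_derive_expR _) lin.
apply: (@is_derive_eq _ _ _ _ _ _ _ _ (is_deriveZ c e)).
by rewrite /GRing.scale/= mulrCA mulrC.
Qed.

Lemma continuous_expR_decay (R : realType) (nu c b : R) :
  continuous (fun y => c * expR (- nu * (b - y))).
Proof.
move=> x; apply/differentiable_continuous/derivable1_diffP.
exact: (@ex_derive _ _ _ _ _ _ _ (is_derive_expR_decay nu c b x)).
Qed.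

(** The bound does not depend on the length of the interval; this is what makes
    the constant [K] of (ii) uniform in [t]. *)
Lemma integral_expR_decay (R : realType) (nu c a b : R) :
  0 < nu -> 0 <= c -> a <= b ->
  (\int[@lebesgue_measure R]_(x in `[a, b]) (c * expR (- nu * (b - x)))%:E
     <= (c / nu)%:E)%E.
Proof.
move=> nu0 c0; rewrite le_eqVlt => /orP[/eqP <-|ab].
  by rewrite set_itv1 integral_set1 lee_fin divr_ge0// ltW.
rewrite (@continuous_FTC2 _ _ (fun x => c / nu * expR (- nu * (b - x))))//.
- rewrite subrr mulr0 expR0 mulr1 -EFinB lee_fin gerBl.
  by rewrite mulr_ge0 ?expR_ge0// divr_ge0// ltW.
- by apply: continuous_subspaceT; exact: continuous_expR_decay.
- split.
  + by move=> x _; exact: (@ex_derive _ _ _ _ _ _ _ (is_derive_expR_decay nu (c / nu) b x)).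
  + by apply: cvg_at_right_filter; exact: continuous_expR_decay.
  + by apply: cvg_at_left_filter; exact: continuous_expR_decay.
- move=> x _; rewrite derive1E.
  rewrite (@derive_val _ _ _ _ _ _ _ (is_derive_expR_decay nu (c / nu) b x)).
  by rewrite divfK// gt_eqF.
Qed.

(** * From an integral bound to exponential growth *)

(** With [n] the integer part of [(t - s) / L], [n] periods give the factor
    [expR n] and the remaining fraction of a period costs at most [B]; replacing
    [n] by [(t - s) / L] loses one more factor [expR 1]. *)
Lemma exponential_growth_of_periodic_growth (R : realType) (g : R -> R)
    (t0 B L : R) :
  0 < L -> (forall t, 0 <= g t) ->
  (forall s t, t0 <= s -> s <= t -> g s <= B * g t) ->
  (forall s, t0 <= s -> expR 1 * g s <= g (s + L)) ->
  forall s t, t0 <= s -> s <= t ->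
    expR (L^-1 * (t - s)) * g s <= B * expR 1 * g t.
Proof.
move=> L0 g0 gB gL s t t0s st.
have iterated n : forall u v, t0 <= u -> u + n%:R * L <= v ->
    expR n%:R * g u <= B * g v.
  (* The period is split off at the start, so that [B] is paid only once. *)
  elim: n => [|n IHn] u v t0u.
    by rewrite mul0r addr0 expR0 mul1r; exact: gB.
  rewrite -natr1 mulrDl mul1r => unv.
  rewrite expRD -mulrA; apply: (@le_trans _ _ (expR n%:R * g (u + L))).
    by rewrite ler_wpM2l ?expR_ge0 ?gL.
  by apply: IHn; lra.
have q0 : 0 <= (t - s) / L by rewrite divr_ge0 ?subr_ge0// ltW.
have /andP[nq qn] := truncn_itv q0.
rewrite (@le_trans _ _ (expR 1 * (expR (Num.trunc ((t - s) / L))%:R * g s)))//.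
  rewrite mulrA -expRD ler_wpM2r// ler_expR [L^-1 * _]mulrC nat1r.
  exact: ltW.
rewrite [B * _]mulrC -mulrA ler_wpM2l ?expR_ge0//; apply: iterated => //.
by move: nq; rewrite ler_pdivlMr// => nq; lra.
Qed.

(** A Markov-type bound: the integral over [[t0, t]] is at least the part of it
    over [[s, r]], where the integrand is at least [c `^ p]. *)
Lemma powR_lower_bound_of_integral_bound (R : realType) (g : R -> R)
    (p K t0 s r t c : R) :
  0 <= p -> (forall t, 0 <= g t) -> measurable_fun `[t0, t] g ->
  t0 <= s -> s <= r -> r <= t -> 0 <= c ->
  (forall tau, s <= tau -> tau <= r -> c <= g tau) ->
  (\int[@lebesgue_measure R]_(tau in `[t0, t]) (g tau `^ p)%:E
     <= (K * g t `^ p)%:E)%E ->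
  (r - s) * c `^ p <= K * g t `^ p.
Proof.
move=> p0 g0 mg t0s sr rt c0 cg; rewrite -lee_fin; apply: le_trans.
have mgp : measurable_fun `[t0, t] (fun tau => (g tau `^ p)%:E).
  apply/measurable_EFinP.
  exact: (measurableT_comp (measurable_powR p)).
have sub : `[s, r] `<=` `[t0, t].
  move=> x /=; rewrite !in_itv/= => /andP[sx xr].
  by rewrite (le_trans t0s sx) (le_trans xr rt).
apply: (@le_trans _ _
  (\int[@lebesgue_measure R]_(tau in `[s, r]) (g tau `^ p)%:E)%E); last first.
  apply: ge0_subset_integral => //.
  by move=> x _; rewrite lee_fin powR_ge0.
apply: (@le_trans _ _
  (\int[@lebesgue_measure R]_(tau in `[s, r]) (cst (c `^ p)%:E tau))%E).
  rewrite integral_cst//= lebesgue_measure_itv/= lte_fin.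
  case: ltP => [_|rs]; first by rewrite -EFinB -EFinM mulrC.
  by rewrite (_ : r = s) ?subrr ?mul0r ?mule0//; apply/eqP; rewrite eq_le sr rs.
apply: ge0_le_integral => //.
- by move=> x _; rewrite lee_fin powR_ge0.
- exact: measurable_funS mgp.
- move=> x /=; rewrite in_itv/= => /andP[sx xr].
  by rewrite lee_fin ge0_ler_powR ?nnegrE// cg.
Qed.

(** The converse implication for one orbit.  The constants are displayed, instead
    of being quantified existentially, because they have to be chosen before
    [x0] and [t0]. *)
Lemma exponential_growth_of_integral_bound (R : realType) (g : R -> R)
    (p M K omega t0 : R) :
  1 <= p -> 1 <= M -> 1 <= K -> 0 < omega -> (forall t, 0 <= g t) ->
  (forall t, measurable_fun `[t0, t] g) ->
  (forall t s, t0 <= s -> s <= t -> g s <= M * expR (omega * (t - s)) * g t) ->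
  (forall t, t0 <= t ->
     (\int[@lebesgue_measure R]_(tau in `[t0, t]) (g tau `^ p)%:E
        <= (K * g t `^ p)%:E)%E) ->
  let B := K * (M * expR omega) in
  let L := K * (B * expR 1) `^ p in
  forall s t, t0 <= s -> s <= t ->
    expR (L^-1 * (t - s)) * g s <= B * expR 1 * g t.
Proof.
move=> p1 M1 K1 omega0 g0 mg gM gint B L.
have p0 : 0 < p by apply: lt_le_trans p1.
have K0 : 0 < K by apply: lt_le_trans K1.
have M0 : 0 < M by apply: lt_le_trans M1.
pose a := M * expR omega.
have a0 : 0 < a by rewrite mulr_gt0 ?expR_gt0.
have B0 : 0 < B by rewrite mulr_gt0.
have powR_le x y : 0 <= x -> 0 <= y -> x `^ p <= y `^ p -> x <= y.
  move=> x0 y0; rewrite leNgt => /negP xy; rewrite leNgt; apply/negP => yx.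
  by apply: xy; apply: gt0_ltr_powR.
have unit_step s t : t0 <= s -> s <= t -> t <= s + 1 -> g s <= a * g t.
  move=> t0s st ts; apply: le_trans (gM _ _ t0s st) _.
  rewrite ler_wpM2r// ler_wpM2l ?(ltW M0)// ler_expR ger_pMr//; lra.
have gB s t : t0 <= s -> s <= t -> g s <= B * g t.
  move=> t0s st; case: (leP t (s + 1)) => [ts|/ltW ts].
    apply: le_trans (unit_step _ _ t0s st ts) _.
    by rewrite ler_wpM2r// ler_peMl// ltW.
  suff : g s / a <= K * g t by rewrite ler_pdivrMr// mulrAC.
  apply: powR_le.
  - by rewrite divr_ge0// ltW.
  - by rewrite mulr_ge0// ltW.
  (* As [1 <= K] and [1 <= p], [K] is at most [K `^ p]; this spares a p-th root. *)
  apply: (@le_trans _ _ (K * g t `^ p)); last exact: le1r_powRZ.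
  rewrite -[leLHS]mul1r -{1}(addrK s 1) (addrC 1).
  apply: (@powR_lower_bound_of_integral_bound _ _ _ _ t0) (gint _ _) => //.
  - exact: ltW.
  - by rewrite lerDl.
  - by rewrite divr_ge0// ltW.
  - by move=> tau st' ts'; rewrite ler_pdivrMr// mulrC unit_step.
  - exact: le_trans st.
have L0 : 0 < L by rewrite mulr_gt0 ?powR_gt0 ?mulr_gt0 ?expR_gt0.
apply: exponential_growth_of_periodic_growth => // s t0s.
apply: powR_le; rewrite ?mulr_ge0 ?expR_ge0//.
(* [L] is the length for which [L * (g s / B) `^ p = K * (expR 1 * g s) `^ p]. *)
rewrite -(ler_pM2l K0).
have -> : expR 1 * g s = (B * expR 1) * (g s / B).
  by field; rewrite gt_eqF.
have Be0 : 0 <= B * expR 1 by rewrite mulr_ge0 ?expR_ge0// ltW.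
have gB0 : 0 <= g s / B by rewrite divr_ge0// ltW.
rewrite powRM// mulrA -/L.
rewrite -{1}(addrK s L) (addrC L).
have sL : s <= s + L by rewrite lerDl ltW.
apply: (@powR_lower_bound_of_integral_bound _ _ _ _ t0) (gint _ _) => //.
- exact: ltW.
- move=> tau st' _; rewrite ler_pdivrMr// mulrC; exact: gB.
- exact: le_trans sL.
Qed.

(** * The equivalence *)

Theorem theorem13 (R : realType) (X : completeNormedModType R)
    (U : R -> R -> {linear X -> X}) (hU : evolution_operator U) :
  weakly_exponentially_unstable U <->
  exists p M K omega : R,
    [/\ 1 <= p, 1 <= M, 1 <= K, 0 < omega &
      forall x0 : X, exists t0 : R,
        [/\ 0 <= t0,
            (forall t s : R, t0 <= s -> s <= t ->
               `|U s t0 x0| <= M * expR (omega * (t - s)) * `|U t t0 x0|) &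
            (forall t : R, t0 <= t ->
               (\int[@lebesgue_measure R]_(tau in `[t0, t])
                  (`|U tau t0 x0| `^ p)%:E
                <= (K * `|U t t0 x0| `^ p)%:E)%E)]].
Proof.
split=> [[N [nu [N1 nu0 hN]]]|[p [M [K [omega [p1 M1 K1 omega0 h]]]]]].
  have N0 : 0 <= N by apply: le_trans N1.
  (* [N / nu] alone might be less than [1]. *)
  exists 1, N, (1 + N / nu), nu; split => //.
    by rewrite lerDl divr_ge0// ltW.
  move=> x0; have [t0 t0_ge0 growth] := hN x0; exists t0.
  have decay t s : t0 <= s -> s <= t ->
      `|U s t0 x0| <= N * `|U t t0 x0| * expR (- nu * (t - s)).
    move=> t0s st; rewrite mulNr expRN ler_pdivlMr ?expR_gt0// mulrC.
    exact: growth.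
  split=> // [t s t0s st|t t0t].
    apply: le_trans (decay _ _ t0s st) _; rewrite mulrAC ler_wpM2r//.
    rewrite ler_wpM2l// ler_expR mulNr (@le_trans _ _ 0)// ?oppr_le0;
    by rewrite mulr_ge0 ?subr_ge0// ltW.
  rewrite powRr1//.
  apply: (@le_trans _ _ (N * `|U t t0 x0| / nu)%:E); last first.
    by rewrite lee_fin mulrAC ler_wpM2r// lerDr.
  have c0 : 0 <= N * `|U t t0 x0| by rewrite mulr_ge0.
  apply: le_trans (integral_expR_decay nu0 c0 t0t).
  apply: ge0_le_integral => //.
  - apply/measurable_EFinP.
    apply: (measurableT_comp (measurable_powR 1)).
    exact: measurable_trajectory_norm.
  - apply/measurable_EFinP; apply: measurable_funTS.
    by apply: continuous_measurable_fun; exact: continuous_expR_decay.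
  - move=> tau /=; rewrite in_itv/= => /andP[t0tau taut].
    by rewrite lee_fin powRr1//; exact: decay.
pose B := K * (M * expR omega); pose L := K * (B * expR 1) `^ p.
exists (B * expR 1), L^-1.
have K0 : 0 < K by apply: lt_le_trans K1.
have expR_ge1 (x : R) : 0 <= x -> 1 <= expR x by move=> ?; rewrite -expR0 ler_expR.
have B1 : 1 <= B by rewrite !mulr_ege1// expR_ge1// ltW.
have B0 : 0 < B by apply: lt_le_trans B1.
split.
- by rewrite mulr_ege1// expR_ge1.
- by rewrite invr_gt0 mulr_gt0// powR_gt0// (mulr_gt0 B0 (expR_gt0 1)).
move=> x0; have [t0 [t0_ge0 lower int_bound]] := h x0.
exists t0 => // t s t0s st.
apply: (@exponential_growth_of_integral_bound _ (fun tau => `|U tau t0 x0|)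
  p M K omega t0) => // r; exact: measurable_trajectory_norm.
Qed.
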